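(* Let $I\subset\mathbb{R}$ be an interval. A proper triharmonic helix $\gamma\colon I\to\mathbb{S}^n\subset\mathbb{R}^{n+1}$ parametrized by arclength must be one of the following: (1) A circle of the form ($n\geq 2$) $$\gamma(s)=\cos(\sqrt{3}s)e_1+\sin(\sqrt{3}s)e_2+e_3,$$ where $e_i\in\mathbb{R}^{n+1}$, $i=1,2,3$, are mutually perpendicular constant vectors satisfying $|e_1|^2=|e_2|^2=\frac13$, $|e_3|^2=\frac23$. (2) A non-planar curve of the form ($n\geq 3$) $$\gamma(s)=\cos(as)e_1+\sin(as)e_2+\cos(bs)e_3+\sin(bs)e_4$$ with $a,b\in\mathbb{R}$ and mutually perpendicular constant vectors $e_i\in\mathbb{R}^{n+1}$, $i=1,\ldots,4$, such that $|e_1|^2=|e_2|^2$, $|e_3|^2=|e_4|^2$, $|e_1|^2+|e_3|^2=1$, satisfying $$a^4+b^4-4(a^2+b^2)+3a^2b^2+3=0,\qquad |e_1|^2a^2+|e_3|^2b^2=1.$$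
   Context: $\mathbb{S}^n\subset\mathbb{R}^{n+1}$ is the unit sphere with the round metric, with curvature tensor $R(X,Y)Z=\langle Y,Z\rangle X-\langle X,Z\rangle Y$. Let $T=\gamma'$ and let $\nabla_T$ be covariant differentiation along $\gamma$ for the Levi-Civita connection. A curve is called triharmonic if it is a critical point of $E_3(\gamma)=\frac12\int_I|\nabla_T^{2}T|^2\,ds$, equivalently if $$0=\nabla_T^5T+R(\nabla_T^3T,T)T-R(\nabla_T^2T,\nabla_TT)T.$$ A geodesic is a curve with $\nabla_TT=0$; a triharmonic curve is called proper if it is not a geodesic. Parametrized by arclength means $|\gamma'|=1$. A helix is a curve whose geodesic curvatures $k_i$, $i=1,2,\ldots$, are all constant. Here, for a curve parametrized by arclength in an $n$-dimensional manifold, the Frenet frame is an orthonormal frame $F_1,\ldots,F_n$ along $\gamma$ with $$F_1=T,\quad \nabla_TF_1=k_1F_2,\quad \nabla_TF_i=-k_{i-1}F_{i-1}+k_iF_{i+1}\ (i=2,\ldots,n-1),\quad \nabla_TF_n=-k_{n-1}F_{n-1},$$ and $k_1,\ldots,k_{n-1}$ are the geodesic curvatures of $\gamma$. *)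

(* Defs.v *)
From HB Require Import structures.
From mathcomp Require Import all_boot all_order all_algebra.
From mathcomp Require Import all_classical all_reals all_analysis.
Set Implicit Arguments.
Unset Strict Implicit.
Unset Printing Implicit Defensive.
Import Order.TTheory GRing.Theory Num.Theory.
Import numFieldNormedType.Exports.
Local Open Scope classical_set_scope.
Local Open Scope ring_scope.

(* The library norm `|x| on row vectors is the sup norm, so Euclidean lengths
   are always expressed through [dot]. *)
Definition dot (R : realType) (m : nat) (u v : 'rV[R]_m) : R := (u *m v^T) 0 0.

Definition mutually_perp (R : realType) (m : nat) (s : seq 'rV[R]_m) : bool :=
  pairwise (fun u v => dot u v == 0) s.

Definition sphere (R : realType) (n : nat) : set 'rV[R]_n.+1 :=
  [set x | dot x x = 1].

Definition nondegenerate_interval (R : realType) (I : set R) : Prop :=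
  is_interval I /\ exists x y, [/\ I x, I y & x < y].

(* Derivatives are taken relative to I: the difference quotient at s only uses
   points of I, hence it is one-sided at an endpoint of I belonging to I, and it
   is the usual derivative at interior points.  Outside I the value of
   [deriv_on] is irrelevant. *)
Definition derivable_on_at (R : realType) (V : normedModType R) (I : set R)
    (f : R -> V) (s : R) : Prop :=
  cvg ((t - s)^-1 *: (f t - f s) @[t --> within I s^']).

Definition deriv_on (R : realType) (V : normedModType R) (I : set R)
    (f : R -> V) (s : R) : V :=
  lim ((t - s)^-1 *: (f t - f s) @[t --> within I s^']).

Definition smooth_on (R : realType) (V : normedModType R) (I : set R)
    (f : R -> V) : Prop :=
  forall (k : nat) (s : R), I s -> derivable_on_at I (iter k (deriv_on I) f) s.

Section CurvesInSphere.
Variables (R : realType) (n : nat) (I : set R) (gamma : R -> 'rV[R]_n.+1).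

Definition curve_in_sphere : Prop :=
  smooth_on I gamma /\ forall s, I s -> sphere (gamma s).

Definition velocity : R -> 'rV[R]_n.+1 := deriv_on I gamma.

Definition arclength_param : Prop :=
  forall s, I s -> Num.sqrt (dot (velocity s) (velocity s)) = 1.

(* The Levi-Civita connection of the round metric is the orthogonal projection
   to T_{gamma s} S^n = (gamma s)^perp of the derivative in R^(n+1). *)
Definition nablaT (X : R -> 'rV[R]_n.+1) (s : R) : 'rV[R]_n.+1 :=
  deriv_on I X s - dot (deriv_on I X s) (gamma s) *: gamma s.

Definition curv (X Y Z : 'rV[R]_n.+1) : 'rV[R]_n.+1 :=
  dot Y Z *: X - dot X Z *: Y.

Definition nablaT_T (j : nat) : R -> 'rV[R]_n.+1 := iter j nablaT velocity.

(* The Euler-Lagrange equation of the energy (1/2) int_I |nabla_T^2 T|^2. *)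
Definition triharmonic : Prop :=
  forall s, I s ->
    0 = nablaT_T 5 s
        + curv (nablaT_T 3 s) (velocity s) (velocity s)
        - curv (nablaT_T 2 s) (nablaT_T 1 s) (velocity s).

Definition geodesic : Prop := forall s, I s -> nablaT velocity s = 0.

Definition proper_triharmonic : Prop := triharmonic /\ ~ geodesic.

(* Only F 1, ..., F n and k 1, ..., k n.-1 are meaningful.  The guard 1 < n
   avoids a reference to k 0, F 0 and F n.+1 when n = 1. *)
Record frenet_frame (F : nat -> R -> 'rV[R]_n.+1) (k : nat -> R -> R) : Prop := {
  frenet_smooth : forall i, (1 <= i <= n)%N -> smooth_on I (F i);
  frenet_tangent : forall i s, (1 <= i <= n)%N -> I s ->
    dot (F i s) (gamma s) = 0;
  frenet_orthonormal : forall i j s, (1 <= i <= n)%N -> (1 <= j <= n)%N -> I s ->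
    dot (F i s) (F j s) = (i == j)%:R;
  frenet_T : forall s, I s -> F 1%N s = velocity s;
  frenet_first : forall s, (1 < n)%N -> I s ->
    nablaT (F 1%N) s = k 1%N s *: F 2%N s;
  frenet_mid : forall i s, (2 <= i <= n.-1)%N -> I s ->
    nablaT (F i) s = - k i.-1 s *: F i.-1 s + k i s *: F i.+1 s;
  frenet_last : forall s, (1 < n)%N -> I s ->
    nablaT (F n) s = - k n.-1 s *: F n.-1 s
}.

Definition helix : Prop :=
  exists F k, frenet_frame F k /\
    forall i, (1 <= i <= n.-1)%N -> exists c : R, forall s, I s -> k i s = c.

(* Planar: the image lies in an affine 2-plane p + span(u, v) of R^(n+1). *)
Definition planar : Prop :=
  exists p u v : 'rV[R]_n.+1, forall s, I s ->
    exists x y : R, gamma s = p + x *: u + y *: v.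

End CurvesInSphere.

(* Main.v *)
Require Import Defs.
From mathcomp Require Import all_boot all_order all_algebra.
From mathcomp Require Import all_classical all_reals all_analysis.
From mathcomp Require Import ring lra.
Set Implicit Arguments.
Unset Strict Implicit.
Unset Printing Implicit Defensive.
Import Order.TTheory GRing.Theory Num.Theory.
Import numFieldNormedType.Exports.
Local Open Scope classical_set_scope.
Local Open Scope ring_scope.

(** With constant curvatures, the components of the triharmonic equation along
    F_2 and F_4 read, for k_1 <> 0,
    (k_1^2 + k_2^2)^2 + k_2^2 k_3^2 = 2 k_1^2 + k_2^2 and
    k_2 k_3 (k_1^2 + k_2^2 + k_3^2 + k_4^2 - 1) = 0;
    the two are incompatible if k_2 k_3 <> 0.  Hence k_2 k_3 = 0, and gamma, F_1,
    F_2, F_3 solve a linear system with constant coefficients, by which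
    gamma'''' + (1 + k_1^2 + k_2^2) gamma'' + k_2^2 gamma = 0.  If k_2 = 0, then
    k_1^2 = 2 and gamma is a circle.  Otherwise the characteristic polynomial has
    roots +- i a, +- i b with a^2, b^2 > 0 distinct, and gamma is the sum of its
    projections to the two modes, each of which is a harmonic oscillator. *)

(** * Derivatives relative to an interval *)

Section Derivatives.
Context {R : realType} (I : set R).
Hypothesis ndI : nondegenerate_interval I.

(** A relation, so that existence and value come together: [deriv_on] is a [lim] and has some value
    even where the quotient does not converge. *)
Definition has_deriv {V : normedModType R} (f : R -> V) (s : R) (l : V) : Prop :=
  (t - s)^-1 *: (f t - f s) @[t --> within I s^'] --> l.

(** A second point [z] of the interval, pulled towards [s] along the segment, stays in [I] by
    convexity and comes arbitrarily close to [s]. Uniqueness of derivatives rests on this, also at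
    endpoints. *)
Lemma within_dnbhs_proper s : I s -> ProperFilter (within I s^').
Proof.
case: ndI => itvI [x [y [Ix Iy xy]]] Is.
apply: Build_ProperFilter_ex => A.
rewrite /within /= /dnbhs /within /= => nA.
have [z [Iz zs]] : exists z, I z /\ z != s.
  have [xs|xs] := eqVneq x s; last by exists x.
  by exists y; split => //; rewrite -xs gt_eqF.
case/nbhs_ballP : nA => e /= e0 eA.
pose r := Num.min 1 (e / 2 / `|z - s|).
have zs0 : 0 < `|z - s| by rewrite normr_gt0 subr_eq0.
have r0 : 0 < r by rewrite lt_min ltr01 !divr_gt0.
have r1 : r <= 1 by rewrite ge_min lexx.
have re : r * `|z - s| < e.
  apply: (@le_lt_trans _ _ (e / 2)); last lra.
  by rewrite -ler_pdivlMr // ge_min lexx orbT.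
exists (s + r * (z - s)); apply: eA => /=.
- by rewrite /ball /= opprD addrA subrr add0r normrN normrM gtr0_norm.
- have : r * (z - s) != 0 by apply: mulf_neq0; [rewrite gt_eqF|rewrite subr_eq0].
  by apply: contra_neq => E; lra.
- have [sz|zs'] := leP s z.
    by apply: (itvI s z) => //; nra.
  by apply: (itvI z s) => //; nra.
Qed.

Section Vector.
Context {V : normedModType R}.
Implicit Types (f g : R -> V) (l m : V).

Lemma has_deriv_unique f s l m :
  I s -> has_deriv f s l -> has_deriv f s m -> l = m.
Proof.
move=> Is; have := within_dnbhs_proper Is => PF.
exact: cvg_unique.
Qed.

Lemma deriv_onE f s l : I s -> has_deriv f s l -> deriv_on I f s = l.
Proof. by move=> Is; have := within_dnbhs_proper Is => PF; apply: cvg_lim. Qed.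

Lemma has_deriv_on f s : derivable_on_at I f s -> has_deriv f s (deriv_on I f s).
Proof. by []. Qed.

Lemma eq_has_deriv f g s l :
  (forall t, I t -> f t = g t) -> I s -> has_deriv f s l -> has_deriv g s l.
Proof.
move=> fg Is; apply: cvg_trans; apply: fmap_within_eq => t /set_mem It.
by rewrite !fg.
Qed.

Lemma eq_deriv_on f g s :
  (forall t, I t -> f t = g t) -> I s -> deriv_on I f s = deriv_on I g s.
Proof.
move=> fg Is; rewrite /deriv_on; congr (lim _).
by apply/seteqP; split; apply: (@fmap_within_eq _ I _ s^') => t /set_mem It; rewrite !fg.
Qed.

Lemma has_deriv_cst l s : has_deriv (fun=> l) s 0.
Proof.
rewrite /has_deriv (_ : (fun t => _) = fun=> 0); first exact: cvg_cst.
by apply/funext => t; rewrite subrr scaler0.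
Qed.

Lemma has_derivD f g s l m : has_deriv f s l -> has_deriv g s m ->
  has_deriv (fun t => f t + g t) s (l + m).
Proof.
move=> df dg; rewrite /has_deriv.
rewrite (_ : (fun t => _) = fun t => (t - s)^-1 *: (f t - f s) + (t - s)^-1 *: (g t - g s)).
  exact: cvgD.
by apply/funext => t; rewrite -scalerDr opprD addrACA.
Qed.

Lemma has_derivZ c f s l : has_deriv f s l -> has_deriv (fun t => c *: f t) s (c *: l).
Proof.
move=> df; rewrite /has_deriv.
rewrite (_ : (fun t => _) = fun t => c *: ((t - s)^-1 *: (f t - f s))).
  by apply: cvgZl_tmp; exact: df.
by apply/funext => t; rewrite -scalerBr !scalerA mulrC.
Qed.

Lemma has_deriv_cvg f s l : has_deriv f s l -> f t @[t --> within I s^'] --> f s.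
Proof.
move=> df.
have FF : Filter (within I s^') by exact: within_filter.
have ts0 : (t - s) @[t --> s] --> (0 : R).
  by rewrite -[X in _ --> X](subrr s); apply: cvgB; [exact: cvg_id|exact: cvg_cst].
have ts : (t - s) @[t --> within I s^'] --> (0 : R).
  apply: (@cvg_within_filter _ R _ s^' _ (nbhs (0 : R))).
  exact: (@cvg_within_filter _ R _ (nbhs s) _ (nbhs (0 : R))).
(* Off [s], [f t] is [t - s] times the difference quotient, plus [f s]. *)
have H : (t - s) *: ((t - s)^-1 *: (f t - f s)) + f s @[t --> within I s^'] --> f s.
  rewrite -[X in _ --> X]add0r -(scale0r l).
  by apply: cvgD; [exact: cvgZ|exact: cvg_cst].
apply: cvg_trans H; apply: near_eq_cvg.
near=> t; rewrite scalerA mulfV ?scale1r ?subrK //.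
rewrite subr_eq0; near: t.
exact: (@cvg_within _ s^' _ I _ (nbhs_dnbhs_neq s)).
Unshelve. all: by end_near. Qed.

End Vector.

Lemma has_derivM (f g : R -> R) s l m : has_deriv f s l -> has_deriv g s m ->
  has_deriv (fun t => f t * g t) s (l * g s + f s * m).
Proof.
move=> df dg; rewrite /has_deriv.
rewrite (_ : (fun t => _) = fun t => ((t - s)^-1 *: (f t - f s)) * g t
   + f s * ((t - s)^-1 *: (g t - g s))).
  apply: cvgD; first by apply: cvgM => //; exact: has_deriv_cvg dg.
  by apply: cvgM => //; exact: cvg_cst.
by apply/funext => t; rewrite /GRing.scale /=; ring.
Qed.

Lemma has_deriv_sum m (f : 'I_m -> R -> R) s (l : 'I_m -> R) :
  (forall i, has_deriv (f i) s (l i)) ->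
  has_deriv (fun t => \sum_i f i t) s (\sum_i l i).
Proof.
elim: m f l => [|m IH] f l df.
  rewrite big_ord0; have := has_deriv_cst (0 : R) s.
  by congr has_deriv; apply/funext => t; rewrite big_ord0.
rewrite big_ord_recl; have := has_derivD (df ord0) (IH _ _ (fun i => df (lift ord0 i))).
by congr has_deriv; apply/funext => t; rewrite big_ord_recl.
Qed.


End Derivatives.

Arguments has_derivZ {R I V} c [f s l] _.

(** * Comparison with two-sided derivatives, constancy, and the Euclidean inner product *)

Lemma dnbhs_shift {R : realType} (s : R) : (fun h : R => h + s) @ 0^' = s^'.
Proof.
apply/seteqP; split => A H.
  have : \forall h \near (0 : R), h != 0 -> A (h + s) by exact: H.
  rewrite (near_shift s) => H'.
  change (\forall t \near s, t != s -> A t).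
  apply: filterS H' => t /=; rewrite sub0r -addrA addNr addr0 => At ts.
  by apply: At; rewrite subr_eq0.
have : \forall t \near s, t != s -> A t by exact: H.
rewrite (near_shift 0) => H'.
change (\forall h \near (0 : R), h != 0 -> A (h + s)).
apply: filterS H' => t /=; rewrite subr0 => At ts; apply: At.
by apply: contra_neq ts => E; apply: (addIr s); rewrite add0r.
Qed.

Section ScalarDerivatives.
Context {R : realType} (I : set R).

(** The substitution [t = h + s] links the quotient of [is_derive], with [h] tending to 0, to the
    one of [has_deriv]. *)
Lemma fmap_diff_quotient (f : R -> R) (s : R) :
  (fun h : R => h^-1 *: ((f \o shift s) (h *: 1) - f s)) @ 0^' =
  (fun t => (t - s)^-1 *: (f t - f s)) @ s^'.
Proof.
rewrite -(dnbhs_shift s).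
rewrite (_ : (fun h => _) = (fun t => (t - s)^-1 *: (f t - f s)) \o +%R^~ s) //.
by apply/funext => h /=; rewrite addrK /GRing.scale /= mulr1.
Qed.

Lemma is_derive_has_deriv (f : R -> R) (s l : R) : is_derive s (1 : R) f l -> has_deriv I f s l.
Proof.
case=> df fl; rewrite /has_deriv.
apply: (@cvg_within_filter _ R _ s^' _ (nbhs l)).
by rewrite -fmap_diff_quotient -fl; exact: df.
Qed.

Lemma has_deriv_is_derive (f : R -> R) (s l : R) :
  nbhs s I -> has_deriv I f s l -> is_derive s (1 : R) f l.
Proof.
move=> sI df.
have H : h^-1 *: ((f \o shift s) (h *: 1) - f s) @[h --> 0^'] --> l.
  rewrite fmap_diff_quotient; apply: cvg_trans df => A.
  by apply: filterS2 (nbhs_dnbhs sI) => t It; apply.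
split; [by apply/cvg_ex; exists l|exact: cvg_lim].
Qed.

(** The mean value theorem on the segment from [x] to [y]: inside it the relative derivative is
    two-sided, and at its ends only continuity is asked for. *)
Lemma has_deriv0_cst (f : R -> R) : is_interval I ->
  (forall s, I s -> has_deriv I f s 0) -> forall x y, I x -> I y -> f x = f y.
Proof.
move=> itvI df.
have H x y : I x -> I y -> x <= y -> f x = f y.
  move=> Ix Iy xy; apply/esym/eqP; rewrite -subr_eq0.
  have sub z : z \in `[x, y] -> I z.
    by rewrite in_itv /=; exact: itvI.
  have dfz z : z \in `]x, y[%R -> is_derive z (1:R) f 0.
    move=> zxy; apply: has_deriv_is_derive; last first.
      by apply: df; apply: sub; apply: subset_itv_oo_cc.
    apply: (@filterS _ _ _ `]x, y[%classic).
      by move=> t /= txy; apply: sub; apply: subset_itv_oo_cc.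
    exact: near_in_itvoo.
  have [|c _ ->] := @MVT_segment R f (fun=> 0) x y xy dfz; last by rewrite mul0r.
  apply/subspace_continuousP => z /= zxy.
  have : f t @[t --> within I z^'] --> f z.
    by apply: has_deriv_cvg; apply: df; exact: sub.
  (* The limit [H] concerns punctured neighbourhoods, so [t = z] is treated apart. *)
  move=> H A Af; have : \forall t \near z, t != z -> I t -> A (f t) by exact: H.
  change ((\forall t \near z, t != z -> I t -> A (f t)) ->
    \forall t \near z, t \in `[x, y] -> A (f t)).
  apply: filterS => t /= At txy; have [->|tz] := eqVneq t z.
    exact: nbhs_singleton Af.
  by apply: At => //; exact: sub.
move=> x y Ix Iy; have [xy|/ltW xy] := leP x y; first exact: H.
by apply/esym; exact: H.
Qed.

Lemma has_deriv_coord m (u : R -> 'rV[R]_m.+1) s l j :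
  has_deriv I u s l -> has_deriv I (fun t => u t 0 j) s (l 0 j).
Proof.
move=> du; rewrite /has_deriv.
rewrite (_ : (fun t => _) = (fun x : 'rV[R]_m.+1 => x 0 j) \o
   fun t => (t - s)^-1 *: (u t - u s)); last by apply/funext => t; rewrite /= !mxE.
apply: continuous_cvg => //; exact: coord_continuous.
Qed.

Lemma dotE m (u v : 'rV[R]_m) : dot u v = \sum_j u 0 j * v 0 j.
Proof. by rewrite /dot mxE; apply: eq_bigr => j _; rewrite mxE. Qed.

Lemma dotC m (u v : 'rV[R]_m) : dot u v = dot v u.
Proof. by rewrite !dotE; apply: eq_bigr => j _; rewrite mulrC. Qed.

Lemma dotDl m (u v w : 'rV[R]_m) : dot (u + v) w = dot u w + dot v w.
Proof. by rewrite /dot mulmxDl mxE. Qed.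

Lemma dotZl m a (u w : 'rV[R]_m) : dot (a *: u) w = a * dot u w.
Proof. by rewrite /dot -scalemxAl mxE. Qed.

Lemma dotNl m (u w : 'rV[R]_m) : dot (- u) w = - dot u w.
Proof. by rewrite -scaleN1r dotZl mulN1r. Qed.

Lemma dot0l m (w : 'rV[R]_m) : dot 0 w = 0.
Proof. by rewrite /dot mul0mx mxE. Qed.

Lemma dotDr m (u v w : 'rV[R]_m) : dot w (u + v) = dot w u + dot w v.
Proof. by rewrite dotC dotDl !(dotC w). Qed.

Lemma dotZr m a (u w : 'rV[R]_m) : dot w (a *: u) = a * dot w u.
Proof. by rewrite dotC dotZl dotC. Qed.

Lemma dotNr m (u w : 'rV[R]_m) : dot w (- u) = - dot w u.
Proof. by rewrite dotC dotNl dotC. Qed.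

Lemma dot0r m (w : 'rV[R]_m) : dot w 0 = 0.
Proof. by rewrite dotC dot0l. Qed.

Definition dot_lin := (@dotDl, @dotDr, @dotZl, @dotZr, @dotNl, @dotNr, @dot0l, @dot0r).

Arguments has_deriv_coord [m u s l] j _.

Lemma has_deriv_dot m (u v : R -> 'rV[R]_m.+1) s l k :
  has_deriv I u s l -> has_deriv I v s k ->
  has_deriv I (fun t => dot (u t) (v t)) s (dot l (v s) + dot (u s) k).
Proof.
move=> du dv; rewrite !dotE -big_split /=.
have := has_deriv_sum
  (fun j => has_derivM (has_deriv_coord j du) (has_deriv_coord j dv)).
by congr has_deriv; apply/funext => t; rewrite dotE.
Qed.

Lemma dot_eq0 m (u : 'rV[R]_m) : dot u u = 0 -> u = 0.
Proof.
move=> /eqP; rewrite dotE psumr_eq0 => [/allP u0|j _]; last by rewrite -expr2 sqr_ge0.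
apply/rowP => j; have := u0 j (mem_index_enum _).
by rewrite mulf_eq0 orbb mxE => /eqP.
Qed.

(** The Gram matrix of the vectors is diagonal with nonzero entries, hence invertible, so they are
    linearly independent. *)
Lemma mutually_perp_leq_rank m p (A : 'M[R]_(p, m)) (s : seq 'rV[R]_m) :
  mutually_perp s -> (forall v, v \in s -> dot v v != 0 /\ (v <= A)%MS) ->
  (size s <= \rank A)%N.
Proof.
move=> ps sA; pose B := \matrix_(i < size s) s`_i.
have rB i : row i B = s`_i by rewrite rowK.
have BB : B *m B^T = diag_mx (\row_i dot s`_i s`_i).
  apply/matrixP => i j; transitivity (dot s`_i s`_j).
    by rewrite -!rB dotE mxE; apply: eq_bigr => k _; rewrite !mxE.
  rewrite !mxE; have [->|ij] := eqVneq i j; first by [].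
  rewrite mulr0n; wlog {ij}lt_ij : i j / (i < j)%N.
    by move=> H; move: ij; rewrite neq_ltn => /orP[/H//|/H <-]; exact: dotC.
  by apply/eqP; apply: (pairwiseP 0 ps) => //; rewrite inE.
have sB : (B <= A)%MS.
  by apply/row_subP => i; rewrite rB; apply: (sA _ _).2; rewrite mem_nth.
apply: leq_trans (mxrankS sB); apply: leq_trans (mxrankM_maxl B B^T).
rewrite mxrank_unit // BB unitmxE det_diag unitfE prodf_seq_neq0.
by apply/allP => i _; rewrite mxE; apply: (sA _ _).1; rewrite mem_nth.
Qed.

End ScalarDerivatives.

Arguments has_deriv_coord {R I m u s l} j _.

(** * The vector-valued harmonic oscillator *)

Section Oscillator.
Context {R : realType} {m : nat} (I : set R).
Hypothesis ndI : nondegenerate_interval I.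
Implicit Types (u v w : R -> 'rV[R]_m.+1).

Lemma has_deriv0_cst_row u :
  (forall s, I s -> has_deriv I u s 0) -> forall x y, I x -> I y -> u x = u y.
Proof.
move=> du x y Ix Iy; apply/rowP => j.
apply: (has_deriv0_cst (f := fun t => u t 0 j) ndI.1) => // s Is.
by have := has_deriv_coord j (du s Is); rewrite mxE.
Qed.

Lemma has_deriv_cosM a s : has_deriv I (fun t => cos (a * t)) s (- a * sin (a * s)).
Proof.
apply: is_derive_has_deriv; apply: is_derive_eq.
by rewrite /GRing.scale /=; ring.
Qed.

Lemma has_deriv_sinM a s : has_deriv I (fun t => sin (a * t)) s (a * cos (a * s)).
Proof.
apply: is_derive_has_deriv; apply: is_derive_eq.
by rewrite /GRing.scale /=; ring.
Qed.

(** If [x] and [y] are the position and velocity at time [s] of a motion cos(at) e + sin(at) f, then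
    [osc_cos] recovers e and [osc_sin] recovers f. *)
Definition osc_cos (a s : R) (x y : 'rV[R]_m.+1) :=
  cos (a * s) *: x - (sin (a * s) / a) *: y.
Definition osc_sin (a s : R) (x y : 'rV[R]_m.+1) :=
  sin (a * s) *: x + (cos (a * s) / a) *: y.

(** Both amplitudes are first integrals: their derivatives vanish along a solution, so they may be
    evaluated at [s] instead of [s0], where the formula reduces to cos^2 + sin^2 = 1. *)
Lemma oscillator (a : R) u w : a != 0 ->
  (forall s, I s -> has_deriv I u s (w s)) ->
  (forall s, I s -> has_deriv I w s (- a ^+ 2 *: u s)) ->
  forall s0 s, I s0 -> I s ->
    u s = cos (a * s) *: osc_cos a s0 (u s0) (w s0)
        + sin (a * s) *: osc_sin a s0 (u s0) (w s0).
Proof.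
move=> a0 du dw s0 s Is0 Is.
have Ecos : osc_cos a s0 (u s0) (w s0) = osc_cos a s (u s) (w s).
  apply/rowP => j; rewrite !mxE.
  apply: (has_deriv0_cst (I := I) (f := fun t =>
     cos (a * t) * u t 0 j + - (sin (a * t) / a * w t 0 j)) ndI.1) => // t It.
  have := has_derivD (has_derivM (@has_deriv_cosM a t) (has_deriv_coord j (du t It)))
    (has_derivZ (- a^-1) (has_derivM (@has_deriv_sinM a t) (has_deriv_coord j (dw t It)))).
  rewrite !mxE /GRing.scale /=; congr has_deriv.
    by apply/funext => x; ring.
  by field.
have Esin : osc_sin a s0 (u s0) (w s0) = osc_sin a s (u s) (w s).
  apply/rowP => j; rewrite !mxE.
  apply: (has_deriv0_cst (I := I) (f := fun t =>
     sin (a * t) * u t 0 j + cos (a * t) / a * w t 0 j) ndI.1) => // t It.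
  have := has_derivD (has_derivM (@has_deriv_sinM a t) (has_deriv_coord j (du t It)))
    (has_derivZ a^-1 (has_derivM (@has_deriv_cosM a t) (has_deriv_coord j (dw t It)))).
  rewrite !mxE /GRing.scale /=; congr has_deriv.
    by apply/funext => x; ring.
  by field.
rewrite Ecos Esin; apply/rowP => j; rewrite !mxE.
have cs := cos2Dsin2 (a * s).
transitivity ((cos (a * s) ^+ 2 + sin (a * s) ^+ 2) * u s 0 j); last by ring.
by rewrite cs mul1r.
Qed.

(** The amplitudes arise from the pair [x], [y / a] by a rotation through the angle [a * s]; the
    hypotheses say that this pair is orthogonal with equal lengths. *)
Lemma osc_norm (a s : R) (x y : 'rV[R]_m.+1) : a != 0 -> dot x y = 0 -> dot y y = a ^+ 2 * dot x x ->
  [/\ dot (osc_cos a s x y) (osc_sin a s x y) = 0,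
      dot (osc_cos a s x y) (osc_cos a s x y) = dot x x &
      dot (osc_sin a s x y) (osc_sin a s x y) = dot x x].
Proof.
move=> a0 xy yy; have cs := cos2Dsin2 (a * s).
rewrite /osc_cos /osc_sin !dot_lin (dotC y x) xy yy; split.
- by field.
- transitivity ((cos (a * s) ^+ 2 + sin (a * s) ^+ 2) * dot x x); first by field.
  by rewrite cs mul1r.
- transitivity ((cos (a * s) ^+ 2 + sin (a * s) ^+ 2) * dot x x); first by field.
  by rewrite cs mul1r.
Qed.

Lemma osc_perp (a s : R) (x y z : 'rV[R]_m.+1) : dot x z = 0 -> dot y z = 0 ->
  dot (osc_cos a s x y) z = 0 /\ dot (osc_sin a s x y) z = 0.
Proof. by move=> xz yz; rewrite /osc_cos /osc_sin !dot_lin xz yz; split; ring. Qed.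

End Oscillator.

(** * Covariant differentiation along the curve *)

Section CovariantDerivative.
Context {R : realType} {n : nat} (I : set R) (gamma : R -> 'rV[R]_n.+1).
Hypothesis ndI : nondegenerate_interval I.
Implicit Types (X Y : R -> 'rV[R]_n.+1).

Definition has_nabla X s (V : 'rV[R]_n.+1) : Prop :=
  exists2 L, has_deriv I X s L & V = L - dot L (gamma s) *: gamma s.

Lemma nablaTE X s V : I s -> has_nabla X s V -> nablaT I gamma X s = V.
Proof. by move=> Is [L dX ->]; rewrite /nablaT (deriv_onE ndI Is dX). Qed.

Lemma eq_nablaT X Y s : (forall t, I t -> X t = Y t) -> I s ->
  nablaT I gamma X s = nablaT I gamma Y s.
Proof. by move=> XY Is; rewrite /nablaT (eq_deriv_on XY Is). Qed.

Lemma has_nablaD X Y s V W : has_nabla X s V -> has_nabla Y s W ->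
  has_nabla (fun t => X t + Y t) s (V + W).
Proof.
move=> [L dX ->] [M dY ->]; exists (L + M); first exact: has_derivD.
by apply/rowP => j; rewrite dotDl !mxE; ring.
Qed.

Lemma has_nablaZ a X s V : has_nabla X s V -> has_nabla (fun t => a *: X t) s (a *: V).
Proof.
move=> [L dX ->]; exists (a *: L); first exact: has_derivZ.
by apply/rowP => j; rewrite dotZl !mxE; ring.
Qed.

Lemma dot_deriv_cst X Y s L M (c : R) : I s ->
  has_deriv I X s L -> has_deriv I Y s M ->
  (forall t, I t -> dot (X t) (Y t) = c) -> dot L (Y s) + dot (X s) M = 0.
Proof.
move=> Is dX dY XYc; apply: has_deriv_unique (has_deriv_dot dX dY) _ => //.
by apply: eq_has_deriv (has_deriv_cst I c s) => // t It; rewrite XYc.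
Qed.

(** Where the curve fails to be geodesic, gamma, T and nabla_T T are nonzero and mutually
    perpendicular, so the ambient dimension n + 1 is at least 3. *)
Lemma dim_gt1 : curve_in_sphere I gamma -> arclength_param I gamma ->
  ~ geodesic I gamma -> (1 < n)%N.
Proof.
move=> [smg Sg] arc ng; have [s [Is Vs0]] : exists s, I s /\ nablaT I gamma (velocity I gamma) s <> 0.
  apply: contrapT => H; apply: ng => s Is; apply: contrapT => ?; apply: H; by exists s.
have VV t : I t -> dot (velocity I gamma t) (velocity I gamma t) = 1.
  move=> It; have := arc t It => /(congr1 (fun x => x ^+ 2)); rewrite expr1n sqr_sqrtr //.
  by rewrite dotE sumr_ge0 // => j _; rewrite -expr2 sqr_ge0.
have dg := has_deriv_on (smg 0%N s Is); have dV := has_deriv_on (smg 1%N s Is).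
have gV : dot (gamma s) (velocity I gamma s) = 0.
  by have := dot_deriv_cst Is dg dg Sg; rewrite /= dotC; rewrite /velocity; lra.
have VdV := dot_deriv_cst Is dV dV VV.
set V := velocity I gamma in gV VV dV VdV Vs0.
have gW : dot (gamma s) (nablaT I gamma V s) = 0.
  by rewrite /nablaT !dot_lin (Sg s Is) (dotC (gamma s)); ring.
have VW : dot (V s) (nablaT I gamma V s) = 0.
  have dVV : dot (deriv_on I V s) (V s) = 0.
    by move: VdV => /=; rewrite (dotC (V s)) -/V; lra.
  by rewrite /nablaT !dot_lin (dotC (V s)) dVV (dotC (V s)) gV; ring.
rewrite -ltnS -(mxrank1 R n.+1).
apply: (@mutually_perp_leq_rank _ _ _ _ [:: gamma s; V s; nablaT I gamma V s]).
  by rewrite /mutually_perp /= gV gW VW eqxx.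
move=> v; rewrite !inE submx1 => /or3P[]/eqP ->.
- by rewrite (Sg s Is) oner_eq0.
- by rewrite VV // oner_eq0.
- split => //; apply/eqP => H; apply: Vs0; exact: dot_eq0.
Qed.

End CovariantDerivative.

(** * Frenet equations and the triharmonic equation in the frame *)

Section Frame.
Context {R : realType} {n : nat} (I : set R) (gamma : R -> 'rV[R]_n.+1).
Context (F : nat -> R -> 'rV[R]_n.+1) (k : nat -> R -> R) (c : nat -> R).
Hypotheses (ndI : nondegenerate_interval I) (n1 : (1 < n)%N).
Hypotheses (curve : curve_in_sphere I gamma) (frF : frenet_frame I gamma F k).
Hypothesis kc : forall i, (1 <= i <= n.-1)%N -> forall s, I s -> k i s = c i.

(* Extending frame and curvatures by zero makes the Frenet equations hold for
   every index. *)
Definition frame (i : nat) : R -> 'rV[R]_n.+1 :=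
  if (0 < i <= n)%N then F i else fun=> 0.
Definition kappa (i : nat) : R := if (0 < i < n)%N then c i else 0.

Lemma frame_perp i s : I s -> dot (frame i s) (gamma s) = 0.
Proof.
move=> Is; rewrite /frame; case: ifP => [hi|_]; last by rewrite dot0l.
exact: (frenet_tangent frF).
Qed.

Lemma dot_frame i j s : I s ->
  dot (frame i s) (frame j s) = ((i == j) && (0 < i <= n)%N)%:R.
Proof.
move=> Is; rewrite /frame; case: ifP => [hi|_]; last by rewrite dot0l andbF.
case: ifP => [hj|hj]; first by rewrite (frenet_orthonormal frF) // andbT.
by rewrite dot0r andbT; case: eqP => // E; rewrite -E hi in hj.
Qed.

Lemma frame1 s : I s -> frame 1 s = velocity I gamma s.
Proof. by move=> Is; rewrite /frame /= (ltnW n1) (frenet_T frF). Qed.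

Lemma has_deriv_curve s : I s -> has_deriv I gamma s (frame 1 s).
Proof. by move=> Is; rewrite frame1 //; apply: has_deriv_on; exact: (curve.1 0%N s Is). Qed.

(** At [i = 1] the term with [i.-1] dies because [kappa 0] is 0, and at [i = n] the last term dies
    because [kappa n] is 0; beyond [n] both sides vanish. *)
Lemma has_nabla_frame i s : I s ->
  has_nabla I gamma (frame i) s (- kappa i.-1 *: frame i.-1 s + kappa i *: frame i.+1 s).
Proof.
move=> Is; have [hi|hi] := boolP (0 < i <= n)%N; last first.
  exists 0; first by rewrite /frame (negPf hi); exact: has_deriv_cst.
  rewrite dot0l scale0r subr0 /kappa; move: hi; case: i => [|i] /= hi.
    by rewrite oppr0 !scale0r addr0.
  have Hi : (n <= i)%N by rewrite leqNgt.
  have -> : (0 < i < n)%N = false by rewrite [(i < n)%N]ltnNge Hi andbF.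
  have -> : (i.+1 < n)%N = false by rewrite ltnNge (leqW Hi).
  by rewrite oppr0 !scale0r addr0.
exists (deriv_on I (frame i) s).
  by rewrite /frame hi; apply: has_deriv_on; have /(_ 0%N s Is) := frenet_smooth frF hi.
rewrite -[RHS]/(nablaT I gamma (frame i) s) {3}/frame hi.
have kE j : (0 < j < n)%N -> kappa j = k j s.
  by move=> hj; rewrite /kappa hj kc // -[(j <= _)%N]ltnS prednK // ltnW.
have fE j : (0 < j <= n)%N -> frame j = F j by rewrite /frame => ->.
move: hi; case: i => // -[|i] /= hi.
  by rewrite (frenet_first frF) // -kE // -fE // {1}/kappa /= oppr0 scale0r add0r.
have [E|ne] := eqVneq i.+2 n.
  have -> : F i.+2 = F n by rewrite E.
  have En : n.-1 = i.+1 by rewrite -E.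
  rewrite (frenet_last frF) // En (kE i.+1) ?(fE i.+1) ?(ltnW hi) //=.
  by rewrite /kappa E ltnn andbF scale0r addr0.
have hlt : (i.+2 < n)%N by rewrite ltn_neqAle ne.
rewrite (frenet_mid frF) /= ?kE ?fE ?(ltnW hi) ?(ltnW hlt) //.
by rewrite -ltnS prednK // ltnW.
Qed.

(** Differentiating the orthogonality of F_i and gamma shows that the component of F_i' along gamma
    is minus the inner product of F_i and T, which is nonzero only for F_1. *)
Lemma has_deriv_frame i s : I s ->
  has_deriv I (frame i) s (- kappa i.-1 *: frame i.-1 s + kappa i *: frame i.+1 s
     - (i == 1%N)%:R *: gamma s).
Proof.
move=> Is; have [L dL /esym/eqP] := has_nabla_frame i Is.
rewrite subr_eq => /eqP LE.
have := dot_deriv_cst ndI Is dL (has_deriv_curve Is) (@frame_perp i).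
rewrite dot_frame // => /eqP; rewrite addr_eq0 => /eqP E.
suff <- : L = - kappa i.-1 *: frame i.-1 s + kappa i *: frame i.+1 s - (i == 1%N)%:R *: gamma s by [].
rewrite {1}LE E -[in RHS]scaleNr; congr (_ + - _ *: _).
by case: eqP => // ->; rewrite (ltnW n1).
Qed.

(** [nablaT] sees only values on [I], so a closed form for one order can be differentiated to give
    the next. *)
Lemma nablaT_T_step j (X Y : R -> 'rV[R]_n.+1) :
  (forall t, I t -> nablaT_T I gamma j t = X t) ->
  (forall t, I t -> has_nabla I gamma X t (Y t)) ->
  forall t, I t -> nablaT_T I gamma j.+1 t = Y t.
Proof.
move=> jX XY t It; rewrite /nablaT_T iterS (eq_nablaT _ jX) //.
by apply: nablaTE => //; exact: XY.
Qed.

Local Notation k1 := (kappa 1).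
Local Notation k2 := (kappa 2).
Local Notation k3 := (kappa 3).
Local Notation k4 := (kappa 4).
Local Notation k5 := (kappa 5).
Local Notation P i s := (frame i s).

Lemma nablaT_T1 s : I s -> nablaT_T I gamma 1 s = k1 *: P 2 s.
Proof.
move: s; apply: (nablaT_T_step (X := frame 1)) => t It; first by rewrite frame1.
have := has_nabla_frame 1 It; congr has_nabla.
by rewrite /= {1}/kappa /= oppr0 scale0r add0r.
Qed.

Lemma nablaT_T2 s : I s ->
  nablaT_T I gamma 2 s = - k1 ^+ 2 *: P 1 s + (k1 * k2) *: P 3 s.
Proof.
move: s; apply: (nablaT_T_step nablaT_T1) => t It.
have := has_nablaZ k1 (has_nabla_frame 2 It); congr has_nabla.
by apply/rowP => j; rewrite !mxE /=; ring.
Qed.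

Lemma nablaT_T3 s : I s ->
  nablaT_T I gamma 3 s =
  - (k1 * (k1 ^+ 2 + k2 ^+ 2)) *: P 2 s + (k1 * k2 * k3) *: P 4 s.
Proof.
move: s; apply: (nablaT_T_step nablaT_T2) => t It.
have := has_nablaD (has_nablaZ (- k1 ^+ 2) (has_nabla_frame 1 It))
  (has_nablaZ (k1 * k2) (has_nabla_frame 3 It)); congr has_nabla.
have k0 : kappa 0 = 0 by [].
by apply/rowP => j; rewrite !mxE /= k0; ring.
Qed.

Lemma nablaT_T4 s : I s ->
  nablaT_T I gamma 4 s =
  (k1 ^+ 2 * (k1 ^+ 2 + k2 ^+ 2)) *: P 1 s
  + ((- (k1 * k2 * (k1 ^+ 2 + k2 ^+ 2 + k3 ^+ 2))) *: P 3 s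
  + (k1 * k2 * k3 * k4) *: P 5 s).
Proof.
move: s; apply: (nablaT_T_step nablaT_T3) => t It.
have := has_nablaD (has_nablaZ (- (k1 * (k1 ^+ 2 + k2 ^+ 2))) (has_nabla_frame 2 It))
  (has_nablaZ (k1 * k2 * k3) (has_nabla_frame 4 It)); congr has_nabla.
by apply/rowP => j; rewrite !mxE /=; ring.
Qed.

Lemma nablaT_T5 s : I s ->
  nablaT_T I gamma 5 s =
  (k1 * ((k1 ^+ 2 + k2 ^+ 2) ^+ 2 + k2 ^+ 2 * k3 ^+ 2)) *: P 2 s
  - (k1 * k2 * k3 * (k1 ^+ 2 + k2 ^+ 2 + k3 ^+ 2 + k4 ^+ 2)) *: P 4 s
  + (k1 * k2 * k3 * k4 * k5) *: P 6 s.
Proof.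
move: s; apply: (nablaT_T_step nablaT_T4) => t It.
have := has_nablaD (has_nablaZ (k1 ^+ 2 * (k1 ^+ 2 + k2 ^+ 2)) (has_nabla_frame 1 It))
  (has_nablaD (has_nablaZ (- (k1 * k2 * (k1 ^+ 2 + k2 ^+ 2 + k3 ^+ 2))) (has_nabla_frame 3 It))
  (has_nablaZ (k1 * k2 * k3 * k4) (has_nabla_frame 5 It))); congr has_nabla.
have k0 : kappa 0 = 0 by [].
by apply/rowP => j; rewrite !mxE /= k0; ring.
Qed.

Lemma triharmonic_curvatures : triharmonic I gamma ->
  k1 * ((k1 ^+ 2 + k2 ^+ 2) ^+ 2 + k2 ^+ 2 * k3 ^+ 2 - (2 * k1 ^+ 2 + k2 ^+ 2)) = 0 /\
  k1 * k2 * k3 * (k1 ^+ 2 + k2 ^+ 2 + k3 ^+ 2 + k4 ^+ 2 - 1) = 0.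
Proof.
have [_ [s [_ [Is _ _]]]] := ndI.
move=> /(_ s Is); rewrite nablaT_T5 // nablaT_T3 // nablaT_T2 // nablaT_T1 //.
rewrite -frame1 // /curv => /esym E; split.
  (* Component along F_2: the curvature terms contribute - k_1 (k_1^2 + k_2^2) and - k_1^3. *)
  have := congr1 (fun v => dot v (P 2 s)) E.
  rewrite !dot_lin !dot_frame //= n1 (ltnW n1) /= => <-; ring.
(* For [n <= 3] there is no F_4, but then [kappa 3] is 0. *)
case n3: (3 < n)%N; last by rewrite /kappa /= n3; ring.
have := congr1 (fun v => - dot v (P 4 s)) E.
rewrite !dot_lin !dot_frame //= n3 (ltnW n1) oppr0 /= => <-; ring.
Qed.

Lemma triharmonic_helix_curvatures : triharmonic I gamma -> k1 != 0 ->
  k2 * k3 = 0 /\ (k1 ^+ 2 + k2 ^+ 2) ^+ 2 = 2 * k1 ^+ 2 + k2 ^+ 2.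
Proof.
move=> /triharmonic_curvatures [/eqP E /eqP G] k10.
move: E; rewrite mulf_eq0 (negPf k10) /= subr_eq0 => /eqP E.
have k23 : k2 * k3 = 0.
  apply/eqP; move: G; rewrite mulf_eq0 -mulrA mulf_eq0 (negPf k10) /=.
  case/orP => // /eqP G; exfalso.
  have a0 : 0 < k1 ^+ 2 by rewrite exprn_even_gt0.
  have b0 := sqr_ge0 k2; have c0 := sqr_ge0 k3; have d0 := sqr_ge0 k4.
  move: E G a0 b0 c0 d0.
  move: (k1 ^+ 2) (k2 ^+ 2) (k3 ^+ 2) (k4 ^+ 2) => x y z w E G x0 y0 z0 w0.
  (* Eliminating [z] from [E] leaves x (x + y - 2) = y w >= 0, whereas x + y = 1 - z - w <= 1 and x
     > 0. *)
  have xy : 0 <= x * (1 - x - y) by apply: mulr_ge0; lra.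
  have yw : 0 <= y * w by apply: mulr_ge0.
  have zE : z = 1 - x - y - w by lra.
  move: E; rewrite zE => E; nra.
by split => //; rewrite -exprMn k23 expr0n /= addr0 in E.
Qed.

End Frame.

(** * Integration of the closed linear system *)

Section Classification.
Context {R : realType} {n : nat} (I : set R) (gamma : R -> 'rV[R]_n.+1).
Hypothesis ndI : nondegenerate_interval I.
(** The third equation is multiplied by [k2]: as k_2 k_3 = 0, its F_4 term drops out and the system
    closes. Unit length of [F3] is assumed separately in the lemmas below, since the extended F_3 is
    zero when n = 2. *)
Variables (F1 F2 F3 : R -> 'rV[R]_n.+1) (k1 k2 : R).
Hypotheses (dg : forall s, I s -> has_deriv I gamma s (F1 s))
  (dF1 : forall s, I s -> has_deriv I F1 s (k1 *: F2 s - gamma s))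
  (dF2 : forall s, I s -> has_deriv I F2 s (- k1 *: F1 s + k2 *: F3 s))
  (dF3 : forall s, I s -> has_deriv I (fun t => k2 *: F3 t) s (- k2 ^+ 2 *: F2 s)).
Hypotheses (gg : forall s, I s -> dot (gamma s) (gamma s) = 1)
  (g1 : forall s, I s -> dot (gamma s) (F1 s) = 0)
  (g2 : forall s, I s -> dot (gamma s) (F2 s) = 0)
  (g3 : forall s, I s -> dot (gamma s) (F3 s) = 0)
  (f11 : forall s, I s -> dot (F1 s) (F1 s) = 1)
  (f22 : forall s, I s -> dot (F2 s) (F2 s) = 1)
  (f12 : forall s, I s -> dot (F1 s) (F2 s) = 0)
  (f13 : forall s, I s -> dot (F1 s) (F3 s) = 0)
  (f23 : forall s, I s -> dot (F2 s) (F3 s) = 0).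
Hypotheses (k10 : k1 != 0)
  (curv : (k1 ^+ 2 + k2 ^+ 2) ^+ 2 = 2 * k1 ^+ 2 + k2 ^+ 2).

Lemma circle_case : k2 = 0 ->
  exists e1 e2 e3 : 'rV[R]_n.+1,
     [/\ mutually_perp [:: e1; e2; e3],
         dot e1 e1 = 1 / 3, dot e2 e2 = 1 / 3, dot e3 e3 = 2 / 3 &
         forall s, I s ->
           gamma s = cos (Num.sqrt 3 * s) *: e1 + sin (Num.sqrt 3 * s) *: e2
                     + e3].
Proof.
move=> k20; have [_ [s0 [_ [Is0 _ _]]]] := ndI.
have kk : k1 ^+ 2 = 2.
  have a0 : k1 ^+ 2 != 0 by rewrite expf_eq0.
  by apply: (mulfI a0); move: curv; rewrite k20; lra.
have a0 : Num.sqrt 3 != 0 :> R by rewrite gt_eqF // sqrtr_gt0.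
have aa : Num.sqrt 3 ^+ 2 = 3 :> R by rewrite sqr_sqrtr.
(* This is - gamma'' / 3, the position relative to the centre [e3] of the circle; it satisfies u' =
   F_1 and F_1' = - 3 u. *)
pose u t := - 3^-1 *: (k1 *: F2 t + -1 *: gamma t).
have du s : I s -> has_deriv I u s (F1 s).
  move=> Is; have := has_derivZ (- 3^-1) (has_derivD (has_derivZ k1 (dF2 Is)) (has_derivZ (-1) (dg Is))).
  congr has_deriv; apply/rowP => j; rewrite !mxE k20.
  transitivity ((k1 ^+ 2 + 1) / 3 * F1 s 0 j); first by field.
  by rewrite kk; field.
have dw s : I s -> has_deriv I F1 s (- Num.sqrt 3 ^+ 2 *: u s).
  move=> Is; have := dF1 Is; congr has_deriv.
  by apply/rowP => j; rewrite aa !mxE; field.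
have osc := oscillator ndI a0 du dw Is0.
pose e3 s := gamma s + -1 *: u s.
have de3 s : I s -> has_deriv I e3 s 0.
  move=> Is; have := has_derivD (dg Is) (has_derivZ (-1) (du s Is)).
  by congr has_deriv; apply/rowP => j; rewrite !mxE; ring.
have ce3 := has_deriv0_cst_row ndI de3.
have uw : dot (u s0) (F1 s0) = 0.
  by rewrite /u !dot_lin (dotC (F2 s0)) f12 // g1 //; ring.
have uu : dot (u s0) (u s0) = 1 / 3.
  transitivity ((k1 ^+ 2 + 1) / 9); last by rewrite kk; field.
  by rewrite /u !dot_lin (dotC (F2 s0) (gamma s0)) g2 // f22 // gg //; field.
have ww : dot (F1 s0) (F1 s0) = Num.sqrt 3 ^+ 2 * dot (u s0) (u s0).
  by rewrite aa uu f11 //; field.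
have [oo oc os] := osc_norm s0 a0 uw ww.
have ug : dot (u s0) (gamma s0) = 1 / 3.
  by rewrite /u !dot_lin (dotC (F2 s0) (gamma s0)) g2 // gg //; field.
clearbody u.
have ue : dot (u s0) (e3 s0) = 0.
  by rewrite /e3 !dot_lin uu ug; ring.
have we : dot (F1 s0) (e3 s0) = 0.
  by rewrite /e3 !dot_lin (dotC _ (u s0)) uw (dotC _ (gamma s0)) g1 //; ring.
have [oce ose] := osc_perp (Num.sqrt 3) s0 ue we.
exists (osc_cos (Num.sqrt 3) s0 (u s0) (F1 s0)), (osc_sin (Num.sqrt 3) s0 (u s0) (F1 s0)), (e3 s0).
split.
- by rewrite /mutually_perp /= oo oce ose eqxx.
- by rewrite oc.
- by rewrite os.
- by rewrite {1}/e3 dotDl dotZl ue /e3 !dot_lin gg // (dotC _ (u s0)) ug; field.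
- move=> s Is; rewrite -osc // (ce3 s0 s) // /e3.
  by apply/rowP => j; rewrite !mxE; ring.
Qed.

(** Differentiating a planar curve gives vectors in the direction space of the plane. The first
    three derivatives yield F_1, k_1 F_2 - gamma and F_3 there: three nonzero mutually perpendicular
    vectors in dimension at most 2. *)
Lemma not_planar : k2 != 0 -> (forall s, I s -> dot (F3 s) (F3 s) = 1) ->
  ~ planar I gamma.
Proof.
move=> k20 f33 [p [u [v puv]]]; have [_ [s0 [_ [Is0 _ _]]]] := ndI.
pose A := (u + v)%MS.
have rkA : (\rank A < 3)%N.
  rewrite ltnS; apply: leq_trans (mxrank_adds_leqif u v).1 _.
  exact: leq_add (rank_leq_row u) (rank_leq_row v).
(* Membership as the vanishing of finitely many inner products with constant vectors, a form that
   passes to derivatives. *)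
have cokerP (X : 'rV[R]_n.+1) :
    (X <= A)%MS <-> forall j, dot X (row j (cokermx A)^T) = 0.
  have XA j : dot X (row j (cokermx A)^T) = (X *m cokermx A) 0 j.
    by rewrite mxE dotE; apply: eq_bigr => i _; rewrite !mxE.
  rewrite submxE; split => [/eqP E j|E]; first by rewrite XA E mxE.
  by apply/eqP/rowP => j; rewrite -XA E mxE.
have derA (X Y : R -> 'rV[R]_n.+1) q : (forall s, I s -> has_deriv I X s (Y s)) ->
    (forall s, I s -> (X s - q <= A)%MS) -> forall s, I s -> (Y s <= A)%MS.
  move=> dX XA s Is; apply/cokerP => j; set w := row j _.
  have := dot_deriv_cst ndI Is (dX s Is) (has_deriv_cst I w s)
    (c := dot q w); rewrite dot0r addr0; apply => t It.
  have /cokerP/(_ j) := XA t It; rewrite !dot_lin -/w => /eqP.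
  by rewrite subr_eq0 => /eqP.
have F1A : forall s, I s -> (F1 s <= A)%MS.
  apply: (derA _ _ p dg) => s Is; have [x [y ->]] := puv s Is.
  have -> : p + x *: u + y *: v - p = x *: u + y *: v.
    by apply/rowP => j; rewrite !mxE; ring.
  by apply: addmx_sub_adds; exact: scalemx_sub.
have F2A : forall s, I s -> (k1 *: F2 s - gamma s <= A)%MS.
  by apply: (derA _ _ 0 dF1) => s Is; rewrite subr0; exact: F1A.
have F3A : forall s, I s -> (k1 *: (- k1 *: F1 s + k2 *: F3 s) - F1 s <= A)%MS.
  apply: (derA (fun s => k1 *: F2 s - gamma s) _ 0) => s Is; last by rewrite subr0; exact: F2A.
  have := has_derivD (has_derivZ k1 (dF2 Is)) (has_derivZ (-1) (dg Is)).
  by rewrite scaleN1r; congr has_deriv; apply/funext => t; rewrite scaleN1r.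
have F3sA : (F3 s0 <= A)%MS.
  (* The third derivative of gamma is k_1 k_2 F_3 - (k_1^2 + 1) F_1, solved for F_3. *)
  have -> : F3 s0 = (k1 * k2)^-1 *: ((k1 *: (- k1 *: F1 s0 + k2 *: F3 s0) - F1 s0)
      + (k1 ^+ 2 + 1) *: F1 s0).
    by apply/rowP => j; rewrite !mxE; field; rewrite k10 k20.
  by rewrite scalemx_sub // addmx_sub ?F3A // scalemx_sub // F1A.
suff : (3 <= \rank A)%N by rewrite leqNgt rkA.
apply: (mutually_perp_leq_rank (s := [:: F1 s0; k1 *: F2 s0 - gamma s0; F3 s0])).
  by rewrite /mutually_perp /= !dot_lin f12 // f13 // f23 // g3 // (dotC (F1 s0)) g1 //
     !mulr0 subr0 eqxx.
move=> w; rewrite !inE => /or3P[]/eqP ->.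
- by rewrite f11 // oner_eq0 F1A.
- rewrite !dot_lin f22 // (dotC (F2 s0)) g2 // gg // F2A //; split => //.
  by rewrite gt_eqF //; have := sqr_ge0 k1; lra.
- by rewrite f33 // oner_eq0 F3sA.
Qed.

Lemma quadratic_roots : k2 != 0 -> exists x y : R,
  [/\ 0 < x, 0 < y, x != y, x + y = 1 + k1 ^+ 2 + k2 ^+ 2 & x * y = k2 ^+ 2].
Proof.
move=> k20; pose S := 1 + k1 ^+ 2 + k2 ^+ 2; pose D := S ^+ 2 - 4 * k2 ^+ 2.
have k1p : 0 < k1 ^+ 2 by rewrite exprn_even_gt0.
have k2p : 0 < k2 ^+ 2 by rewrite exprn_even_gt0.
have Dp : 0 < D.
  (* The factors are S - 2 k_2 and S + 2 k_2, both positive since k_1 is nonzero; hence the roots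
     are distinct. *)
  have -> : D = (k1 ^+ 2 + (1 - k2) ^+ 2) * (k1 ^+ 2 + (1 + k2) ^+ 2).
    by rewrite /D /S; ring.
  by apply: mulr_gt0; apply: ltr_wpDr; rewrite ?sqr_ge0.
pose d := Num.sqrt D.
have dp : 0 < d by rewrite sqrtr_gt0.
have dd : d ^+ 2 = D by rewrite sqr_sqrtr // ltW.
have Sp : 0 < S by rewrite /S; lra.
have dS : d < S.
  by rewrite -(ltr_pXn2r (n := 2)) ?nnegrE ?ltW // dd /D; lra.
exists ((S + d) / 2), ((S - d) / 2); split; [lra|lra| |rewrite /S; lra|].
  by apply/eqP; lra.
transitivity ((S ^+ 2 - d ^+ 2) / 4); first by field.
by rewrite dd /D; field.
Qed.

Section Mode.
Context (x y : R) (x0 : 0 < x) (xy : x != y).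
Hypotheses (sxy : x + y = 1 + k1 ^+ 2 + k2 ^+ 2) (pxy : x * y = k2 ^+ 2).

(* The projection of gamma to the eigenspace of the second derivative for the
   eigenvalue -x. *)
Definition mode (t : R) : 'rV[R]_n.+1 :=
  (y - x)^-1 *: (k1 *: F2 t + (y - 1) *: gamma t).
Definition mode' (t : R) : 'rV[R]_n.+1 :=
  (y - x)^-1 *: ((y - 1 - k1 ^+ 2) *: F1 t + k1 *: (k2 *: F3 t)).

Lemma has_deriv_mode s : I s -> has_deriv I mode s (mode' s).
Proof.
move=> Is; have := has_derivZ (y - x)^-1
  (has_derivD (has_derivZ k1 (dF2 Is)) (has_derivZ (y - 1) (dg Is))).
by congr has_deriv; apply/rowP => j; rewrite !mxE; ring.
Qed.

Lemma has_deriv_mode' s : I s -> has_deriv I mode' s (- x *: mode s).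
Proof.
move=> Is; have := has_derivZ (y - x)^-1
  (has_derivD (has_derivZ (y - 1 - k1 ^+ 2) (dF1 Is)) (has_derivZ k1 (dF3 Is))).
congr has_deriv; apply/rowP => j; rewrite !mxE.
have yE : y - 1 - k1 ^+ 2 = k2 ^+ 2 - x.
  transitivity (x + y - x - 1 - k1 ^+ 2); first by ring.
  by rewrite sxy; ring.
transitivity ((y - x)^-1 * (k1 * (y - 1 - k1 ^+ 2 - k2 ^+ 2) * F2 s 0 j
   - (y - 1 - k1 ^+ 2) * gamma s 0 j)); first by ring.
by rewrite yE -pxy; ring.
Qed.

(** By Vieta, X^2 - (1 + k_1^2 + k_2^2) X + k_2^2 takes the value - k_1^2 at 1. With this, inner
    products of modes become functions of [x] and [y] alone. *)
Lemma sqr_k1E : k1 ^+ 2 = (1 - x) * (y - 1).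
Proof.
have -> : k1 ^+ 2 = x + y - 1 - k2 ^+ 2 by rewrite sxy; ring.
by rewrite -pxy; ring. Qed.

Lemma dot_mode_mode' s : I s -> dot (mode s) (mode' s) = 0.
Proof.
move=> Is; rewrite /mode /mode' !dot_lin (dotC (F2 s)) f12 // f23 // g1 // g3 //.
by ring.
Qed.

Lemma dot_mode s : I s -> dot (mode s) (mode s) = (y - 1) / (y - x).
Proof.
move=> Is; rewrite /mode !dot_lin (dotC (F2 s) (gamma s)) f22 // g2 // gg //.
transitivity ((y - x)^-1 ^+ 2 * (k1 ^+ 2 + (y - 1) ^+ 2)); first by ring.
by rewrite sqr_k1E; field; rewrite subr_eq0 eq_sym.
Qed.

(** Together with [dot_mode_mode'], this is the hypothesis of [osc_norm] at frequency sqrt(x), and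
    gives the two amplitudes of a mode equal length. *)
Lemma dot_mode' s : (forall s, I s -> dot (F3 s) (F3 s) = 1) -> I s ->
  dot (mode' s) (mode' s) = x * dot (mode s) (mode s).
Proof.
move=> f33 Is; rewrite dot_mode // /mode' !dot_lin (dotC (F3 s) (F1 s)) f11 // f13 // f33 //.
transitivity ((y - x)^-1 ^+ 2 * ((y - 1 - k1 ^+ 2) ^+ 2 + k1 ^+ 2 * k2 ^+ 2)); first by ring.
by rewrite sqr_k1E -pxy; field; rewrite subr_eq0 eq_sym.
Qed.

End Mode.

Lemma helix_case : k2 != 0 -> (forall s, I s -> dot (F3 s) (F3 s) = 1) ->
   exists (a b : R) (e1 e2 e3 e4 : 'rV[R]_n.+1),
     [/\ mutually_perp [:: e1; e2; e3; e4],
         [/\ dot e1 e1 = dot e2 e2, dot e3 e3 = dot e4 e4 &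
             dot e1 e1 + dot e3 e3 = 1],
         a ^+ 4 + b ^+ 4 - 4 * (a ^+ 2 + b ^+ 2) + 3 * a ^+ 2 * b ^+ 2 + 3 = 0,
         dot e1 e1 * a ^+ 2 + dot e3 e3 * b ^+ 2 = 1 &
         forall s, I s ->
           gamma s = cos (a * s) *: e1 + sin (a * s) *: e2
                     + cos (b * s) *: e3 + sin (b * s) *: e4].
Proof.
move=> k20 f33; have [_ [s0 [_ [Is0 _ _]]]] := ndI.
have [x [y [x0 y0 xy sxy pxy]]] := quadratic_roots k20.
have yx : y != x by rewrite eq_sym.
have syx : y + x = 1 + k1 ^+ 2 + k2 ^+ 2 by rewrite addrC.
have pyx : y * x = k2 ^+ 2 by rewrite mulrC.
have kk := sqr_k1E sxy pxy.
have ax : Num.sqrt x ^+ 2 = x by rewrite sqr_sqrtr // ltW.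
have ay : Num.sqrt y ^+ 2 = y by rewrite sqr_sqrtr // ltW.
have a0 : Num.sqrt x != 0 by rewrite gt_eqF // sqrtr_gt0.
have b0 : Num.sqrt y != 0 by rewrite gt_eqF // sqrtr_gt0.
pose u := mode x y; pose u' := mode' x y; pose v := mode y x; pose v' := mode' y x.
(* The two modes and their velocities are mutually orthogonal at [s0]; this is the source of the
   orthogonality of their amplitudes. *)
have dot_uv' : dot (u' s0) (v' s0) = 0.
  rewrite /u' /v' /mode' !dot_lin (dotC (F3 s0) (F1 s0)) f11 // f13 // f33 //.
  transitivity ((y - x)^-1 * (x - y)^-1 * ((y - 1 - k1 ^+ 2) * (x - 1 - k1 ^+ 2) + k1 ^+ 2 * k2 ^+ 2)); first by ring.
  by rewrite kk -pxy; ring.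
have dot_uv : dot (u s0) (v s0) = 0.
  rewrite /u /v /mode !dot_lin (dotC (F2 s0) (gamma s0)) f22 // g2 // gg //.
  transitivity ((y - x)^-1 * (x - y)^-1 * (k1 ^+ 2 + (y - 1) * (x - 1))); first by ring.
  by rewrite kk; ring.
have dot_u_v' : dot (u s0) (v' s0) = 0.
  by rewrite /u /v' /mode /mode' !dot_lin (dotC (F2 s0)) f12 // f23 // g1 // g3 //; ring.
have dot_u'_v : dot (u' s0) (v s0) = 0.
  by rewrite dotC /v /u' /mode /mode' !dot_lin (dotC (F2 s0)) f12 // f23 // g1 // g3 //; ring.
have [uu uc us] : [/\ _, _ & _] := osc_norm s0 a0 (dot_mode_mode' x y Is0)
  (etrans (dot_mode' xy sxy pxy f33 Is0) (congr1 (fun z => z * _) (esym ax))).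
have [vv vc vs] : [/\ _, _ & _] := osc_norm s0 b0 (dot_mode_mode' y x Is0)
  (etrans (dot_mode' yx syx pyx f33 Is0) (congr1 (fun z => z * _) (esym ay))).
have perp (z : 'rV[R]_n.+1) := osc_perp (Num.sqrt x) s0 (x := u s0) (y := u' s0) (z := z).
have perpv (z : 'rV[R]_n.+1) := osc_perp (Num.sqrt y) s0 (x := v s0) (y := v' s0) (z := z).
(* Orthogonality passes to the amplitudes one side at a time: those of [v] against [u] and [u'],
   then those of [u] against the amplitudes of [v]. *)
have [vcu vsu] : _ /\ _ := perpv (u s0) (etrans (dotC _ _) dot_uv) (etrans (dotC _ _) dot_u_v').
have [vcu' vsu'] : _ /\ _ := perpv (u' s0) (etrans (dotC _ _) dot_u'_v) (etrans (dotC _ _) dot_uv').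
have [ucvc usvc] : _ /\ _ := perp _ (etrans (dotC _ _) vcu) (etrans (dotC _ _) vcu').
have [ucvs usvs] : _ /\ _ := perp _ (etrans (dotC _ _) vsu) (etrans (dotC _ _) vsu').
exists (Num.sqrt x), (Num.sqrt y),
  (osc_cos (Num.sqrt x) s0 (u s0) (u' s0)), (osc_sin (Num.sqrt x) s0 (u s0) (u' s0)),
  (osc_cos (Num.sqrt y) s0 (v s0) (v' s0)), (osc_sin (Num.sqrt y) s0 (v s0) (v' s0)).
have yx0 : y - x != 0 by rewrite subr_eq0.
have xy0 : x - y != 0 by rewrite subr_eq0.
split.
- by rewrite /mutually_perp /= uu vv ucvc ucvs usvc usvs eqxx.
- rewrite uc us vc vs; split => //.
  by rewrite !dot_mode //; field; rewrite ?yx0 ?xy0.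
(* The curvature relation [curv], rewritten with k_1^2 = (1 - x)(y - 1) and k_2^2 = x y, where x =
   a^2 and y = b^2. *)
- rewrite (exprM _ 2 2) (exprM _ 2 2) ax ay.
  by move: curv; rewrite -pxy kk; lra.
- by rewrite uc vc ax ay !dot_mode //; field; rewrite ?yx0 ?xy0.
- move=> s Is.
  have du t : I t -> has_deriv I u t (u' t) by move=> It; exact: has_deriv_mode.
  have du' t : I t -> has_deriv I u' t (- Num.sqrt x ^+ 2 *: u t).
    by rewrite ax => It; exact: has_deriv_mode'.
  have dv t : I t -> has_deriv I v t (v' t) by move=> It; exact: has_deriv_mode.
  have dv' t : I t -> has_deriv I v' t (- Num.sqrt y ^+ 2 *: v t).
    by rewrite ay => It; exact: has_deriv_mode'.
  rewrite -addrA -(oscillator ndI a0 du du' Is0 Is) -(oscillator ndI b0 dv dv' Is0 Is).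
  (* The two projections add up to gamma. *)
  by apply/rowP => j; rewrite /u /v /mode !mxE; field; rewrite ?yx0 ?xy0.
Qed.

End Classification.

(** * The classification of proper triharmonic helices *)

Unset Implicit Arguments.

Theorem theorem1p7 (R : realType) (n : nat) (I : set R)
    (gamma : R -> 'rV[R]_n.+1) :
  nondegenerate_interval I ->
  curve_in_sphere I gamma ->
  arclength_param I gamma ->
  helix I gamma ->
  proper_triharmonic I gamma ->
  ((2 <= n)%N /\
   exists e1 e2 e3 : 'rV[R]_n.+1,
     [/\ mutually_perp [:: e1; e2; e3],
         dot e1 e1 = 1 / 3, dot e2 e2 = 1 / 3, dot e3 e3 = 2 / 3 &
         forall s, I s ->
           gamma s = cos (Num.sqrt 3 * s) *: e1 + sin (Num.sqrt 3 * s) *: e2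
                     + e3])
  \/
  [/\ (3 <= n)%N, ~ planar I gamma &
   exists (a b : R) (e1 e2 e3 e4 : 'rV[R]_n.+1),
     [/\ mutually_perp [:: e1; e2; e3; e4],
         [/\ dot e1 e1 = dot e2 e2, dot e3 e3 = dot e4 e4 &
             dot e1 e1 + dot e3 e3 = 1],
         a ^+ 4 + b ^+ 4 - 4 * (a ^+ 2 + b ^+ 2) + 3 * a ^+ 2 * b ^+ 2 + 3 = 0,
         dot e1 e1 * a ^+ 2 + dot e3 e3 * b ^+ 2 = 1 &
         forall s, I s ->
           gamma s = cos (a * s) *: e1 + sin (a * s) *: e2
                     + cos (b * s) *: e3 + sin (b * s) *: e4]].
Proof.
move=> ndI curve arc [F [k [frF kcst]]] [tri ngeo].
have [_ [s0 [_ [Is0 _ _]]]] := ndI.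
have n1 := dim_gt1 ndI curve arc ngeo.
pose c i := k i s0.
have kc i : (1 <= i <= n.-1)%N -> forall s, I s -> k i s = c i.
  by move=> /kcst [d kd] s Is; rewrite /c !kd.
pose kap := @kappa R n c.
have k10 : kap 1%N != 0.
  (* Since nabla_T T = k_1 F_2, a vanishing k_1 would make the curve a geodesic. *)
  apply/eqP => k10; apply: ngeo => s Is.
  have := nablaT_T1 ndI n1 frF kc Is.
  by rewrite -/(kap 1%N) k10 scale0r.
have [k23 curv] := triharmonic_helix_curvatures ndI n1 frF kc tri k10.
have df i s (Is : I s) := has_deriv_frame ndI n1 curve frF kc (i := i) Is.
have dg s : I s -> has_deriv I gamma s (frame F 1 s) by exact: (has_deriv_curve n1 curve frF).
have dF1 s : I s -> has_deriv I (frame F 1) s (kap 1%N *: frame F 2 s - gamma s).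
  move=> Is; have := df 1%N s Is; congr has_deriv.
  by rewrite /= {1}/kappa /= oppr0 scale0r add0r scale1r.
have dF2 s : I s -> has_deriv I (frame F 2) s (- kap 1%N *: frame F 1 s + kap 2%N *: frame F 3 s).
  by move=> Is; have := df 2%N s Is; congr has_deriv; rewrite /= scale0r subr0.
have dF3 s : I s ->
    has_deriv I (fun t => kap 2%N *: frame F 3 t) s (- kap 2%N ^+ 2 *: frame F 2 s).
  move=> Is; have := has_derivZ (kap 2%N) (df 3%N s Is); congr has_deriv.
  rewrite /= scale0r subr0 scalerDr !scalerA -/(kap 2%N) -/(kap 3%N) k23 scale0r addr0.
  by rewrite mulrN -expr2.
have ff i j s : I s -> dot (frame F i s) (frame F j s) = ((i == j) && (0 < i <= n)%N)%:R.
  by move=> Is; apply: (dot_frame frF).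
have gf i s : I s -> dot (gamma s) (frame F i s) = 0.
  by move=> Is; rewrite dotC (frame_perp frF).
have f11 s : I s -> dot (frame F 1 s) (frame F 1 s) = 1.
  by move=> Is; rewrite ff //= (ltnW n1).
have f22 s : I s -> dot (frame F 2 s) (frame F 2 s) = 1.
  by move=> Is; rewrite ff //= n1.
have f12 s : I s -> dot (frame F 1 s) (frame F 2 s) = 0 by exact: ff.
have f13 s : I s -> dot (frame F 1 s) (frame F 3 s) = 0 by exact: ff.
have f23 s : I s -> dot (frame F 2 s) (frame F 3 s) = 0 by exact: ff.
have gg := curve.2.
have [k20|k20] := eqVneq (kap 2%N) 0.
  left; split => //.
  exact: (circle_case ndI dg dF1 dF2 gg (gf 1%N) (gf 2%N) f11 f22 f12 k10 curv k20).
(* [kappa 2] is 0 by default unless 2 < n. *)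
have n3 : (2 < n)%N.
  by move: k20; rewrite /kap /kappa /=; case: (2 < n)%N; rewrite ?eqxx.
have f33 s : I s -> dot (frame F 3 s) (frame F 3 s) = 1.
  by move=> Is; rewrite ff //= n3.
right; split => //.
  exact: (not_planar ndI dg dF1 dF2 gg (gf 1%N) (gf 2%N) (gf 3%N) f11 f22 f12 f13 f23 k10 k20 f33).
exact: (helix_case ndI dg dF1 dF2 dF3 gg (gf 1%N) (gf 2%N) (gf 3%N) f11 f22 f12 f13 f23 k10 curv k20 f33).
Qed.
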